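(* Let $G=(V,E)$ be a finite graph, let $n_v\in\mathbb{Z}^+$ for each $v\in V$, let $G_v=\overline{K_{3n_v}}$ (the edgeless graph on $3n_v$ vertices), and let $\mathcal{G}=\{G_v : v\in V\}$ (taken pairwise vertex-disjoint). Then the join of $\mathcal{G}$ along $G$, $\nabla\mathcal{G}$, is 3-balanced.
   Context: For a graph $G=(V,E)$ and a collection $\mathcal{G}=\{G_v : v\in V\}$ of pairwise disjoint graphs indexed by $V$, the join of $\mathcal{G}$ along $G$, $\nabla\mathcal{G}$, is the graph obtained from the disjoint union $\bigcup_{v\in V}G_v$ by adding, for every edge $vw\in E$, all possible edges between vertices of $G_v$ and vertices of $G_w$. A graph is 3-balanced if it admits a vertex coloring $\ell:V\to\mathbb{Z}_3$ such that every vertex has, in its open neighborhood, the same number of vertices of each of the three colors. *)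

(* Defs.v *)
From HB Require Import structures.
From mathcomp Require Import all_boot all_order all_algebra.

Set Implicit Arguments.
Unset Strict Implicit.
Unset Printing Implicit Defensive.

Record sgraph := SGraph {
  vertex :> finType;
  edge : rel vertex;
  edge_sym : symmetric edge;
  edge_irrefl : irreflexive edge
}.

Definition open_nbhd (G : sgraph) (v : G) : {set G} := [set w | edge v w].

Definition balanced3 (G : sgraph) : Prop :=
  exists l : G -> 'Z_3, forall (v : G) (a b : 'Z_3),
    #|[set w in open_nbhd v | l w == a]| = #|[set w in open_nbhd v | l w == b]|.

Section Edgeless.
Variable k : nat.

Definition edgeless_rel : rel 'I_k := fun _ _ => false.

Fact edgeless_sym : symmetric edgeless_rel.
Proof. by []. Qed.

Fact edgeless_irrefl : irreflexive edgeless_rel.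
Proof. by []. Qed.

Definition edgeless : sgraph := SGraph edgeless_sym edgeless_irrefl.
End Edgeless.

Section Join.
Variables (G : sgraph) (F : G -> sgraph).

(* The tagged sum makes the vertex sets of the F v disjoint. When
   tag x = tag y, tagged_as x y is tagged y cast to a vertex of F (tag x). *)
Definition join_rel : rel {v : G & F v} := fun x y =>
  (tag x == tag y) && edge (tagged x) (tagged_as x y)
  || edge (tag x) (tag y).

Fact join_sym : symmetric join_rel.
Proof.
move=> [v x] [w y]; rewrite /join_rel /= (edge_sym v w) eq_sym.
congr (_ || _); case: (eqVneq w v) => //= ewv.
by case: v / ewv x => x; rewrite !tagged_asE edge_sym.
Qed.

Fact join_irrefl : irreflexive join_rel.
Proof.
by move=> [v x]; rewrite /join_rel /= tagged_asE !edge_irrefl andbF.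
Qed.

Definition join : sgraph := SGraph join_sym join_irrefl.
End Join.

(* Main.v *)
(** Colour the vertices 0, ..., 3 n_v - 1 of each G_v by their residues modulo 3.
    An open neighbourhood in the join is a union of full fibres G_w, and each
    colour occurs exactly n_w times in G_w. *)

Require Import Defs.
From mathcomp Require Import all_boot all_order all_algebra.

(** Induction on [m]: each further block of [d.+1] consecutive integers meets every residue class
    exactly once. *)
Lemma card_residue_class (d m : nat) (a : 'I_d.+1) :
  #|[pred i : 'I_(d.+1 * m) | inZp i == a]| = m.
Proof.
rewrite -sum1_card.
rewrite -(big_mkord (fun i => inZp i == a) (fun=> 1)).
elim: m => [|m IHm]; first by rewrite muln0 big_geq.
rewrite mulnSr (@big_cat_nat _ _ _ (d.+1 * m)) ?leq_addr //= IHm.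
(* Translate the last block to start at 0; the shift is a multiple of [d.+1], so residues are
   unchanged. *)
rewrite -{1}[d.+1 * m]add0n big_addn addKn big_mkord -[RHS]addn1; congr (_ + _).
rewrite (big_pred1 a) // => i /=.
by rewrite -!val_eqE /= addnC mulnC modnMDl modn_small.
Qed.

Lemma join_edgelessE (G : sgraph) (k : G -> nat)
    (x y : join (fun v => edgeless (k v))) :
  edge x y = edge (tag x) (tag y).
Proof. by rewrite /= /join_rel andbF. Qed.

(** The point is that the resulting sum is independent of [a]. *)
Lemma card_join_edgeless_color (G : sgraph) (d : nat) (n : G -> nat)
    (x : join (fun v => edgeless (d.+1 * n v))) (a : 'I_d.+1) :
  #|[set y in open_nbhd x | inZp (tagged y : 'I_(d.+1 * n (tag y))) == a]|
    = \sum_(w | edge (tag x) w) n w.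
Proof.
rewrite -sum1_card.
under eq_bigl do rewrite !inE join_edgelessE.
rewrite -(@sig_big_dep _ _ _ G (fun w => 'I_(d.+1 * n w)) (edge (tag x))
           (fun w i => inZp i == a) (fun _ _ => 1)).
by apply: eq_bigr => w _; rewrite sum1_card card_residue_class.
Qed.

Theorem theorem6p5 (G : sgraph) (n : G -> nat) (n_gt0 : forall v : G, 0 < n v) :
  balanced3 (join (fun v : G => edgeless (3 * n v))).
Proof.
exists (fun x => inZp (tagged x : 'I_(3 * n (tag x)))) => x a b.
(* ['Z_3] is convertible to ['I_3], so the count applies with [d = 2]. *)
by rewrite !card_join_edgeless_color.
Qed.
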